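(* Let $A$ and $\Delta A$ be real $m\times n$ matrices with $\mathrm{rank}(A)=\mathrm{rank}(A+\Delta A)=n$. Let $\ell_j$ and $\tilde{\ell}_j$, $1\le j\le m$, be the leverage scores of $A$ and $A+\Delta A$, respectively, and let $0\le\theta_1\le\cdots\le\theta_n\le\pi/2$ be the principal angles between $\mathrm{range}(A)$ and $\mathrm{range}(A+\Delta A)$. Then for every $1\le j\le m$ with $\ell_j>0$, $$\frac{|\tilde{\ell}_j-\ell_j|}{\ell_j}\le 2\sqrt{\frac{1-\ell_j}{\ell_j}}\,\cos\theta_1\,\sin\theta_n+\frac{(\sin\theta_n)^2}{\ell_j}.$$
   Context: Leverage scores: if $A$ is a real $m\times n$ matrix with $\mathrm{rank}(A)=n$ and $Q$ is any $m\times n$ matrix whose columns form an orthonormal basis of $\mathrm{range}(A)$, the leverage scores of $A$ are $\ell_j=\|e_j^TQ\|_2^2$, $1\le j\le m$, where $e_j$ is the $j$th column of the $m\times m$ identity (this is independent of the choice of $Q$). Principal angles: let $Q$ and $\tilde{Q}$ be $m\times n$ matrices whose columns are orthonormal bases of $\mathrm{range}(A)$ and $\mathrm{range}(A+\Delta A)$. Let $Q^T\tilde{Q}=U\Sigma V^T$ be an SVD with $U,V$ orthogonal $n\times n$ and $\Sigma=\mathrm{diag}(\cos\theta_1,\ldots,\cos\theta_n)$, $1\ge\cos\theta_1\ge\cdots\ge\cos\theta_n\ge0$. Then $0\le\theta_1\le\cdots\le\theta_n\le\pi/2$ are the principal angles between $\mathrm{range}(A)$ and $\mathrm{range}(A+\Delta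 A)$. *)

(* Defs.v *)
From HB Require Import structures.
From mathcomp Require Export all_boot all_order all_algebra.
From mathcomp Require Export reals trigo.

Set Implicit Arguments.
Unset Strict Implicit.
Unset Printing Implicit Defensive.

Import Order.TTheory GRing.Theory Num.Theory.
Local Open Scope ring_scope.

Definition norm2 (R : realType) (n : nat) (v : 'rV[R]_n) : R :=
  Num.sqrt (\sum_(k < n) v 0 k ^+ 2).

(* MathComp row spaces are used: range(A) is the row space of A^T. *)
Definition orthonormal_basis_of_range (R : realType) (m n : nat)
    (A Q : 'M[R]_(m, n)) : Prop :=
  Q^T *m Q = 1%:M /\ (Q^T :=: A^T)%MS.

(* Both notions below are relations, so that no orthonormal basis or singular
   value decomposition is singled out. *)
Definition leverage_scores (R : realType) (m n : nat)
    (A : 'M[R]_(m, n)) (ell : 'I_m -> R) : Prop :=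
  exists2 Q : 'M[R]_(m, n), orthonormal_basis_of_range A Q
    & forall j : 'I_m, ell j = norm2 (row j Q) ^+ 2.

Definition orthogonal_mx (R : realType) (n : nat) (U : 'M[R]_n) : Prop :=
  U^T *m U = 1%:M.

(* cos is decreasing on [0, pi/2], so the conditions on theta also order the
   diagonal as 1 >= cos theta_1 >= ... >= cos theta_n >= 0. *)
Definition principal_angles (R : realType) (m n : nat)
    (A B : 'M[R]_(m, n)) (theta : 'I_n -> R) : Prop :=
  [/\ forall i : 'I_n, 0 <= theta i <= pi / 2,
      forall i k : 'I_n, (i <= k)%N -> theta i <= theta k
    & exists (Q Qt : 'M[R]_(m, n)) (U V : 'M[R]_n),
      [/\ orthonormal_basis_of_range A Q,
          orthonormal_basis_of_range B Qt,
          orthogonal_mx U,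
          orthogonal_mx V
        & Q^T *m Qt = U *m diag_mx (\row_(i < n) cos (theta i)) *m V^T]].

(* Main.v *)
Require Import Defs.
From mathcomp Require Import all_boot all_order all_algebra.
From mathcomp Require Import reals trigo.
From mathcomp Require Import ring lra.

Set Implicit Arguments.
Unset Strict Implicit.
Unset Printing Implicit Defensive.

Import Order.TTheory GRing.Theory Num.Theory.
Local Open Scope ring_scope.

(** Rotating both orthonormal bases by the singular vectors gives bases [Q1],
    [Q2] with [Q1^T Q2 = C] diagonal. Put [W = Q2 - Q1 C], so [Q1^T W = 0] and
    [W^T W = 1 - C^2], and let [x], [y], [w] be the [j]th rows of [Q1], [Q2],
    [W]. Then [y = x C + w] yields
      [|y|^2 - |x|^2 = 2 <x C, w> + (|w|^2 - x (1 - C^2) x^T)].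
    As [w] is the image under [W] of the component of [e_j] orthogonal to
    range(A), whose squared norm is [1 - l_j], one gets
    [|w|^2 <= (1 - l_j) sin^2 theta_n], and Cauchy-Schwarz bounds the cross
    term. The last bracket is a difference of two numbers of
    [[0, sin^2 theta_n]]. *)

(** * Euclidean inner product of row vectors *)

Definition dot (R : realType) (n : nat) (u v : 'rV[R]_n) : R :=
  (u *m v^T) 0 0.

Section Dot.
Variables (R : realType) (n : nat).
Implicit Types u v w : 'rV[R]_n.

Lemma dotE u v : dot u v = \sum_k u 0 k * v 0 k.
Proof. by rewrite /dot mxE; apply: eq_bigr => k _; rewrite mxE. Qed.

Lemma dotC u v : dot u v = dot v u.
Proof. by rewrite !dotE; apply: eq_bigr => k _; rewrite mulrC. Qed.

Lemma dotDl u v w : dot (u + v) w = dot u w + dot v w.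
Proof. by rewrite /dot mulmxDl mxE. Qed.

Lemma dotDr u v w : dot u (v + w) = dot u v + dot u w.
Proof. by rewrite dotC dotDl !(dotC u). Qed.

Lemma dotNl u v : dot (- u) v = - dot u v.
Proof. by rewrite /dot mulNmx mxE. Qed.

Lemma dotNr u v : dot u (- v) = - dot u v.
Proof. by rewrite dotC dotNl dotC. Qed.

Lemma dotZl a u v : dot (a *: u) v = a * dot u v.
Proof. by rewrite /dot -scalemxAl mxE. Qed.

Lemma dotZr a u v : dot u (a *: v) = a * dot u v.
Proof. by rewrite dotC dotZl dotC. Qed.

Lemma dot_ge0 u : 0 <= dot u u.
Proof. by rewrite dotE; apply: sumr_ge0 => k _; rewrite -expr2 sqr_ge0. Qed.

Lemma dot_mulmxr (p : nat) (v : 'rV[R]_p) (M : 'M[R]_(p, n)) u :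
  dot u (v *m M) = dot (u *m M^T) v.
Proof. by rewrite /dot trmx_mul mulmxA. Qed.

Lemma dot0_eq0 u : dot u u = 0 -> u = 0.
Proof.
rewrite dotE => /eqP; rewrite psumr_eq0; last first.
  by move=> k _; rewrite -expr2 sqr_ge0.
move=> /allP u0; apply/rowP => k; rewrite mxE; apply/eqP.
by have := u0 k (mem_index_enum k); rewrite /= -expr2 sqrf_eq0.
Qed.

(** For [v] nonzero, the squared norm of [<v,v> u - <u,v> v] factors as
    [<v,v> (<u,u> <v,v> - <u,v>^2)], and the positive factor [<v,v>] cancels. *)
Lemma CauchySchwarz_dot u v : dot u v ^+ 2 <= dot u u * dot v v.
Proof.
have [/dot0_eq0 -> | vN0] := eqVneq (dot v v) 0.
  by rewrite /dot trmx0 !mulmx0 mxE expr0n mulr0.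
have v_gt0 : 0 < dot v v by rewrite lt_neqAle eq_sym vN0 dot_ge0.
rewrite -subr_ge0 -(pmulr_rge0 _ v_gt0).
have := dot_ge0 (dot v v *: u - dot u v *: v).
rewrite dotDl !dotDr !dotNl !dotNr !dotZl !dotZr (dotC v u).
by congr (_ <= _); ring.
Qed.

Lemma dot_diagE (c : 'rV[R]_n) u v :
  dot (u *m diag_mx c) v = \sum_k c 0 k * (u 0 k * v 0 k).
Proof.
by rewrite dotE; apply: eq_bigr => k _; rewrite mul_mx_diag mxE; ring.
Qed.

End Dot.

Lemma norm2_sqr (R : realType) (n : nat) (v : 'rV[R]_n) :
  norm2 v ^+ 2 = dot v v.
Proof.
rewrite /norm2 sqr_sqrtr ?dotE; last by apply: sumr_ge0 => k _; rewrite sqr_ge0.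
by apply: eq_bigr => k _; rewrite expr2.
Qed.

(** Both products are the orthogonal projector onto range(A). Each absorbs the other on its right
    because the ranges agree; transposing one of these identities, with both factors symmetric,
    joins them. *)
Lemma orthonormal_basis_proj_unique (R : realType) (m n : nat)
    (A Q Q' : 'M[R]_(m, n)) :
  orthonormal_basis_of_range A Q -> orthonormal_basis_of_range A Q' ->
  Q *m Q^T = Q' *m Q'^T.
Proof.
have absorb (P P' : 'M[R]_(m, n)) : P^T *m P = 1%:M -> (P'^T <= P^T)%MS ->
    P' *m P'^T *m (P *m P^T) = P' *m P'^T.
  move=> PP1 /submxP [D P'E]; rewrite P'E !mulmxA.
  by rewrite -(mulmxA (P' *m D)) PP1 mulmx1.
move=> [QQ1 QA] [QQ1' QA'].
have sQ'Q : (Q'^T <= Q^T)%MS by rewrite QA QA'.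
have sQQ' : (Q^T <= Q'^T)%MS by rewrite QA QA'.
rewrite -[RHS](absorb Q Q' QQ1 sQ'Q); apply: trmx_inj.
by rewrite !(trmx_mul _ (_ *m _)) !trmx_mul !trmxK (absorb Q' Q QQ1' sQQ').
Qed.

Lemma dot_row (R : realType) (m n : nat) (Q : 'M[R]_(m, n)) (j : 'I_m) :
  dot (row j Q) (row j Q) = (Q *m Q^T) j j.
Proof. by rewrite dotE mxE; apply: eq_bigr => k _; rewrite !mxE. Qed.

(** * The bound for two orthonormal bases whose cross Gram matrix is diagonal *)

Section DiagonalBases.
Variables (R : realType) (m n : nat) (Q1 Q2 : 'M[R]_(m, n)) (c : 'rV[R]_n).
Variables (c0 s : R) (j : 'I_m).
Hypotheses (Q1_ortho : Q1^T *m Q1 = 1%:M) (Q2_ortho : Q2^T *m Q2 = 1%:M).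
Hypothesis Q1Q2 : Q1^T *m Q2 = diag_mx c.
Hypotheses (c_ge0 : forall i, 0 <= c 0 i) (c_le : forall i, c 0 i <= c0).
Hypothesis c_le1 : forall i, c 0 i <= 1.
Hypothesis sin2_le : forall i, 1 - c 0 i ^+ 2 <= s ^+ 2.
Hypotheses (c0_ge0 : 0 <= c0) (s_ge0 : 0 <= s).

Let C := diag_mx c.
Let W := Q2 - Q1 *m C.
Let x := row j Q1.
Let y := row j Q2.
Let w := row j W.
Let f := delta_mx 0 j - x *m Q1^T.
Let l := dot x x.

Let c2_le1 i : c 0 i ^+ 2 <= 1.
Proof. by rewrite expr_le1. Qed.

Let yE : y = x *m C + w.
Proof. by rewrite /w /W linearB /= row_mul addrC subrK. Qed.

Let Q1W : Q1^T *m W = 0.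
Proof. by rewrite mulmxBr Q1Q2 mulmxA Q1_ortho mul1mx subrr. Qed.

Let WtW : W^T *m W = 1%:M - C *m C.
Proof.
have Q2Q1 : Q2^T *m Q1 = C.
  by rewrite -[LHS]trmxK trmx_mul trmxK Q1Q2 tr_diag_mx.
have -> : W^T = Q2^T - C *m Q1^T.
  by rewrite /W raddfB /= trmx_mul tr_diag_mx.
rewrite mulmxBl -mulmxA Q1W mulmx0 subr0.
by rewrite mulmxBr Q2_ortho mulmxA Q2Q1.
Qed.

Let fW : f *m W = w.
Proof. by rewrite mulmxBl -mulmxA Q1W mulmx0 subr0 -rowE. Qed.

Let ff : dot f f = 1 - l.
Proof.
have ex : dot (delta_mx 0 j) (x *m Q1^T) = l.
  by rewrite dot_mulmxr trmxK -rowE.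
have xx : dot (x *m Q1^T) (x *m Q1^T) = l.
  by rewrite dot_mulmxr trmxK -mulmxA Q1_ortho mulmx1.
have ee : dot (delta_mx 0 j : 'rV[R]_m) (delta_mx 0 j) = 1.
  by rewrite /dot trmx_delta mul_delta_mx mxE !eqxx.
rewrite /f dotDl !dotDr !dotNl !dotNr (dotC (x *m _)) ex xx ee; ring.
Qed.

(** This is the quadratic form of [1 - C^2]. It is used at [x] for the last bracket of the
    difference and at [w] to control [W W^T]. *)
Let dotCC (u : 'rV[R]_n) :
  dot u u - dot (u *m C) (u *m C) = \sum_k (1 - c 0 k ^+ 2) * u 0 k ^+ 2.
Proof.
rewrite dot_diagE dotE -sumrB; apply: eq_bigr => k _.
by rewrite mul_mx_diag mxE; ring.
Qed.

Let dotCC_ge0 (u : 'rV[R]_n) : 0 <= dot u u - dot (u *m C) (u *m C).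
Proof.
by rewrite dotCC; apply: sumr_ge0 => k _; rewrite mulr_ge0 ?sqr_ge0 ?subr_ge0.
Qed.

Let dotCC_le (u : 'rV[R]_n) :
  dot u u - dot (u *m C) (u *m C) <= s ^+ 2 * dot u u.
Proof.
rewrite dotCC dotE mulr_sumr; apply: ler_sum => k _.
by rewrite -expr2 ler_wpM2r ?sqr_ge0.
Qed.

Let xC_le : dot (x *m C) (x *m C) <= c0 ^+ 2 * l.
Proof.
rewrite /l !dotE mulr_sumr; apply: ler_sum => k _.
rewrite mul_mx_diag mxE -!expr2 exprMn mulrC ler_wpM2r ?sqr_ge0 //.
by rewrite lerXn2r ?nnegrE.
Qed.

Let l_le1 : 0 <= 1 - l.
Proof. by rewrite -ff dot_ge0. Qed.

(** No operator norm is needed: since [w = f W], Cauchy-Schwarz gives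
    [|w|^4 = <f, w W^T>^2 <= |f|^2 |w W^T|^2], where [|w W^T|^2 = w (1 - C^2) w^T <= s^2 |w|^2].
    Dividing by [|w|^2] concludes. *)
Let w_le : dot w w <= (1 - l) * s ^+ 2.
Proof.
have [-> | wN0] := eqVneq (dot w w) 0; first by rewrite mulr_ge0 ?sqr_ge0.
have w_gt0 : 0 < dot w w by rewrite lt_neqAle eq_sym wN0 dot_ge0.
rewrite -(ler_pM2r w_gt0) -expr2.
have -> : dot w w = dot f (w *m W^T) by rewrite dot_mulmxr trmxK fW.
apply: le_trans (CauchySchwarz_dot _ _) _.
rewrite ff -[leRHS]mulrA; apply: ler_wpM2l => //.
(* The earlier rewriting also changed the factor [|w|^2] on the right-hand side; this restores
   it. *)
have -> : dot f (w *m W^T) = dot w w by rewrite dot_mulmxr trmxK fW.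
rewrite dot_mulmxr trmxK -mulmxA WtW mulmxBr mulmx1 dotDl dotNl mulmxA.
by apply: le_trans (dotCC_le w); rewrite dot_mulmxr tr_diag_mx.
Qed.

Let cross_le : `|dot (x *m C) w| <= Num.sqrt (l * (1 - l)) * c0 * s.
Proof.
have -> : Num.sqrt (l * (1 - l)) * c0 * s =
    Num.sqrt ((c0 ^+ 2 * l) * ((1 - l) * s ^+ 2)).
  rewrite -mulrA -(ger0_norm (mulr_ge0 c0_ge0 s_ge0)) -sqrtr_sqr.
  by rewrite -sqrtrM ?mulr_ge0 ?dot_ge0 //; congr Num.sqrt; ring.
rewrite -sqrtr_sqr ler_wsqrtr //; apply: le_trans (CauchySchwarz_dot _ _) _.
by rewrite ler_pM ?dot_ge0.
Qed.

Lemma dot_row_diff_le :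
  `|dot (row j Q2) (row j Q2) - dot (row j Q1) (row j Q1)| <=
    2 * (Num.sqrt (l * (1 - l)) * c0 * s) + s ^+ 2.
Proof.
rewrite -/x -/y -/l yE dotDl !dotDr (dotC w).
have := cross_le; have := w_le; have := dotCC_le x; have := dotCC_ge0 x.
have := l_le1; have := dot_ge0 x; have := dot_ge0 w; rewrite -/l.
have := sqr_ge0 s; move: (s ^+ 2) (Num.sqrt _ * _ * _) => S K.
rewrite !ler_norml => S0 w0 l0 l1 d0 d1 w1 /andP [k0 k1].
(* The upper bound uses [(1 - l) S <= S] on [|w|^2], the lower one [l S <= S] on the bracket; both
   rest on [0 <= l <= 1]. *)
by apply/andP; split; nra.
Qed.

End DiagonalBases.

Theorem corollary2p3 (R : realType) (m n : nat) (A dA : 'M[R]_(m, n.+1))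
    (rankA : \rank A = n.+1) (rankAdA : \rank (A + dA)%R = n.+1)
    (ell ellt : 'I_m -> R)
    (hell : leverage_scores A ell) (hellt : leverage_scores (A + dA) ellt)
    (theta : 'I_n.+1 -> R) (htheta : principal_angles A (A + dA) theta)
    (j : 'I_m) (ellj_gt0 : 0 < ell j) :
  `|ellt j - ell j| / ell j <=
    2 * Num.sqrt ((1 - ell j) / ell j) * cos (theta ord0) * sin (theta ord_max)
    + sin (theta ord_max) ^+ 2 / ell j.
Proof.
case: htheta => th_bnd th_mono [Q [Qt [U [V [hQ hQt hU hV hSVD]]]]].
have [Q' hQ' ellE] := hell; have [Qt' hQt' elltE] := hellt.
(* The bases defining the leverage scores need not be those of the singular value decomposition.
   Neither a change of basis nor an orthogonal factor on the right alters the projector, whose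
   diagonal holds the scores. *)
have rot (P P' : 'M[R]_(m, n.+1)) (X : 'M_n.+1) B :
    orthogonal_mx X -> orthonormal_basis_of_range B P ->
    orthonormal_basis_of_range B P' ->
    norm2 (row j P') ^+ 2 = dot (row j (P *m X)) (row j (P *m X)).
  move=> /mulmx1C hX hP hP'; rewrite norm2_sqr !dot_row.
  rewrite (orthonormal_basis_proj_unique hP' hP) trmx_mul mulmxA.
  by rewrite -(mulmxA P X) hX mulmx1.
have ortho (P : 'M[R]_(m, n.+1)) (X : 'M_n.+1) B : orthogonal_mx X ->
    orthonormal_basis_of_range B P -> (P *m X)^T *m (P *m X) = 1%:M.
  move=> hX [hP _].
  by rewrite trmx_mul mulmxA -(mulmxA X^T) hP mulmx1 hX.
pose c := \row_(i < n.+1) cos (theta i).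
have QUQV : (Q *m U)^T *m (Qt *m V) = diag_mx c.
  rewrite trmx_mul mulmxA -(mulmxA U^T) hSVD !mulmxA hU mul1mx.
  by rewrite -mulmxA hV mulmx1.
have pi2_lepi : (pi / 2 : R) <= pi by have := pi_gt0 R; lra.
have in_0pi i : theta i \in `[0, pi].
  by rewrite in_itv /=; have /andP [-> /le_trans ->] := th_bnd i.
have cos_ge0 i : 0 <= cos (theta i).
  apply: cos_ge0_pihalf; have /andP [h1 ->] := th_bnd i.
  by rewrite andbT; apply: le_trans h1; have := pi_gt0 R; lra.
have cos_mono (i k : 'I_n.+1) : (i <= k)%N -> cos (theta k) <= cos (theta i).
  by move=> ik; rewrite leNgt ltr_cos // -leNgt th_mono.
have sin_max_ge0 : 0 <= sin (theta ord_max).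
  by apply: sin_ge0_pi; have := in_0pi ord_max; rewrite in_itv.
(* The largest cosine belongs to the smallest angle and the largest sine to the largest angle,
   whence [c0] and [s]. *)
have := @dot_row_diff_le R m n.+1 (Q *m U) (Qt *m V) c (cos (theta ord0))
  (sin (theta ord_max)) j.
rewrite -(rot _ _ _ _ hU hQ hQ') -(rot _ _ _ _ hV hQt hQt') -ellE -elltE.
move=> /(_ (ortho _ _ _ hU hQ) (ortho _ _ _ hV hQt) QUQV).
(* Pulling [ell j] out of the root prepares the division by [ell j]. *)
have -> : ell j * (1 - ell j) = ell j ^+ 2 * ((1 - ell j) / ell j).
  by field; rewrite gt_eqF.
rewrite (sqrtrM _ (sqr_ge0 _)) sqrtr_sqr (gtr0_norm ellj_gt0) => bnd.
rewrite ler_pdivrMr // mulrDl divfK ?gt_eqF //.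
apply: le_trans (bnd _ _ _ _ _ _) _ => //.
- by move=> i; rewrite mxE.
- by move=> i; rewrite mxE cos_mono.
- by move=> i; rewrite mxE cos_le1.
- move=> i; rewrite mxE sin2cos2 lerD2l lerN2 lerXn2r ?nnegrE //.
  by rewrite cos_mono // -ltnS.
- by rewrite lerD2r le_eqVlt; apply/orP; left; apply/eqP; ring.
Qed.
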